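(* Let $I\subset[0,\infty)$ be an interval with interior $I^{\circ}$, let $f:I\to\mathbb{R}$ be three times differentiable on $I^{\circ}$, and let $a,b\in I^{\circ}$ with $a<b$ be such that $f'''\in L[a,b]$. Let $q>1$ and let $p$ satisfy $\frac1p+\frac1q=1$. Suppose that, for some fixed $s\in(0,1]$, the function $|f'''|^q$ is $s$-convex in the second sense on $[a,b]$. Then $$\left|\int_a^b f(x)\,dx-\frac{b-a}{6}\left[f(a)+4f\left(\frac{a+b}{2}\right)+f(b)\right]\right|\le \frac{(b-a)^4}{6}\left(\frac{1}{192}\right)^{1-\frac1q}$$ $$\times\left\{\left(\frac{2^{-4-s}}{(3+s)(4+s)}|f'''(a)|^q+\frac{2^{-4-s}\left(34+2^{4+s}(-2+s)+11s+s^2\right)}{(1+s)(2+s)(3+s)(4+s)}|f'''(b)|^q\right)^{\frac1q}\right.$$ $$\left.+\left(\frac{2^{-4-s}\left(34+2^{4+s}(-2+s)+11s+s^2\right)}{(1+s)(2+s)(3+s)(4+s)}|f'''(a)|^q+\frac{2^{-4-s}}{(3+s)(4+s)}|f'''(b)|^q\right)^{\frac1q}\right\}.$$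
   Context: $L[a,b]$ denotes the Lebesgue integrable functions on $[a,b]$. For fixed $s\in(0,1]$, a real-valued function $g$ is $s$-convex in the second sense on $[a,b]\subset[0,\infty)$ if $g(\alpha x+\beta y)\le \alpha^s g(x)+\beta^s g(y)$ for all $x,y\in[a,b]$ and all $\alpha,\beta\ge 0$ with $\alpha+\beta=1$. *)

(* Defs.v *)
From HB Require Import structures.
From mathcomp Require Import all_boot all_order all_algebra.
From mathcomp Require Import all_classical all_reals all_analysis.

Set Implicit Arguments.
Unset Strict Implicit.
Unset Printing Implicit Defensive.

Import Order.TTheory GRing.Theory Num.Theory.
Import numFieldNormedType.Exports.

Local Open Scope ring_scope.
Local Open Scope classical_set_scope.

(* To be used on an open set [A]: differentiability at the points of [A] and
   the restriction of [f^`(k)] to [A] then only depend on the values of [f] on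
   [A], so the total function [f] stands for any partial function defined at
   least on [A]. *)
Definition times_derivable_on (R : realType) (n : nat) (A : set R)
    (f : R -> R) : Prop :=
  forall k, (k < n)%N -> forall x, A x -> derivable f^`(k) x 1.

(* For [0 < s], [0 `^ s = 0], so [alpha `^ s] is the usual real power at the
   end points [alpha = 0] and [alpha = 1] as well. *)
Definition s_convex_second_sense (R : realType) (s : R) (D : set R)
    (g : R -> R) : Prop :=
  forall x y, D x -> D y ->
  forall alpha beta : R, 0 <= alpha -> 0 <= beta -> alpha + beta = 1 ->
  g (alpha * x + beta * y) <= alpha `^ s * g x + beta `^ s * g y.

(* Main.v *)
Require Import Defs.
From HB Require Import structures.
From mathcomp Require Import all_boot all_order all_algebra.
From mathcomp Require Import all_classical all_reals all_analysis.
From mathcomp Require Import ring lra.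
Import Order.TTheory GRing.Theory Num.Theory.
Import numFieldNormedType.Exports.
Local Open Scope ring_scope.
Local Open Scope classical_set_scope.

(** Put [c = b - a] and [m = (a + b) / 2].  Integrating by parts three times on
    each half of [[a, b]] writes the error of Simpson's rule as
      [c ^+ 4 / 6 * (E_b - E_a)],
    where [E_a], [E_b] are integrals over [[0, 1 / 2]] of the cubic kernel
    [t ^+ 2 * (t - 1 / 2)] against [f''' (a + c t)] and [f''' (b - c t)]; the
    boundary terms in [f' m] agree and cancel.  Hölder's inequality with weight
    [w t = t ^+ 2 * (1 / 2 - t)], whose integral is [1 / 192], and the
    s-convexity of [|f'''| ^ q] then reduce the bound to the two integrals
    of [w t * t ^ s] and [w t * (1 - t) ^ s].

    No integral of [f'''] is ever formed.  A derivative that exists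
    everywhere need not be continuous, so every integral [\int w u] is replaced
    by the increment of an explicit primitive, and integration of an
    inequality by the mean value theorem: [|Z'| <= W'] gives
    [|Z r - Z l| <= W r - W l] ([derive_norm_le]).  Hölder's
    inequality becomes [holder_derive]: Young's inequality [le_young], with a
    free parameter [mu], bounds [|Z'|] by the derivative of a known function,
    and the choice of [mu] that minimises the resulting bound
    produces the product of powers ([le_young_optimal]).

    The integration by parts is the observation that, for the kernel [K],
    [Z = K F'' - K' F' + K'' F - K''' J] with [J' = F] has [Z' = K F''']
    ([simpson_half_error]).  The two halves are the cases [h = c] and [h = - c]
    of [simpson_half_error_affine].  Only [f] itself is integrated, through
    [exists_primitive]. *)

(** * Comparison of increments *)

Lemma within_continuousZl (R : realType) (A : set R) (c : R) (F : R -> R) :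
  {within A, continuous F} -> {within A, continuous (fun t => c * F t)}.
Proof.
move=> cF x.
exact: (@continuousM R (subspace A) (cst c) F x
  (@cst_continuous _ _ c x) (cF x)).
Qed.

Lemma within_continuousD (R : realType) (A : set R) (F G : R -> R) :
  {within A, continuous F} -> {within A, continuous G} ->
  {within A, continuous (fun t => F t + G t)}.
Proof.
move=> cF cG x.
exact: (@continuousD R R^o (subspace A) F G x (cF x) (cG x)).
Qed.

Lemma ge0_derive_le (R : realType) (l r : R) (V dV : R -> R) :
  l <= r -> {within `[l, r], continuous V} ->
  (forall t, t \in `]l, r[%R -> is_derive t 1 V (dV t)) ->
  (forall t, t \in `]l, r[%R -> 0 <= dV t) ->
  V l <= V r.
Proof.
move=> lr cV hV V0.
apply: (@ger0_derive1_ndecr _ V l r) => // t tlr.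
  by have := hV t tlr; case.
by rewrite derive1E; have /@derive_val -> := hV t tlr; exact: V0.
Qed.

(** This stands in for [|\int Z'| <= \int W'], with no integrability of [Z']:
    both [W - Z] and [W + Z] are nondecreasing. *)
Lemma derive_norm_le (R : realType) (l r : R) (Z dZ W dW : R -> R) :
  l <= r -> {within `[l, r], continuous Z} -> {within `[l, r], continuous W} ->
  (forall t, t \in `]l, r[%R -> is_derive t 1 Z (dZ t)) ->
  (forall t, t \in `]l, r[%R -> is_derive t 1 W (dW t)) ->
  (forall t, t \in `]l, r[%R -> `|dZ t| <= dW t) ->
  `|Z r - Z l| <= W r - W l.
Proof.
move=> lr cZ cW hZ hW ZW.
have H1 : W l - Z l <= W r - Z r.
  apply: (@ge0_derive_le R l r (fun t => W t - Z t) (fun t => dW t - dZ t)) => //.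
  - by move=> x; apply: continuousB; [exact: cW|exact: cZ].
  - by move=> t tlr; have := hZ t tlr; have := hW t tlr => ? ?; exact: is_deriveB.
  - by move=> t /ZW; rewrite ler_norml subr_ge0 => /andP[].
have H2 : W l + Z l <= W r + Z r.
  apply: (@ge0_derive_le R l r (fun t => W t + Z t) (fun t => dW t + dZ t)) => //.
  - by move=> x; apply: continuousD; [exact: cW|exact: cZ].
  - by move=> t tlr; have := hZ t tlr; have := hW t tlr => ? ?; exact: is_deriveD.
  - by move=> t /ZW; rewrite ler_norml -lerBlDr sub0r => /andP[+ _]; lra.
by rewrite ler_norml; apply/andP; split; lra.
Qed.

(** * Hölder's inequality for increments *)

(** Young's inequality for the product of [v * mu ^ (1/q - 1)] and
    [mu ^ (1 - 1/q)].  At [v = mu] both sides agree: for fixed [mu] the right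
    side is the affine function of [v ^ q] tangent there to [v]. *)
Lemma le_young (R : realType) (q mu v : R) : 1 < q -> 0 < mu -> 0 <= v ->
  v <= q^-1 * mu `^ (1 - q) * v `^ q + (1 - q^-1) * mu.
Proof.
move=> q1 mu0 v0.
have q0 : 0 < q by lra.
have iq1 : q^-1 < 1 by rewrite invf_lt1.
have p0 : 0 < (1 - q^-1)^-1 by rewrite invr_gt0 subr_gt0.
have := @conjugate_powR R (v * mu `^ (q^-1 - 1)) (mu `^ (1 - q^-1)) q _
  (mulr_ge0 v0 (powR_ge0 _ _)) (powR_ge0 _ _) q0 p0 _.
rewrite invrK subrKC => /(_ erefl).
rewrite -mulrA -powRD ?(gt_eqF mu0) ?implybT// => H.
move: H; have -> : q^-1 - 1 + (1 - q^-1) = 0 by lra.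
rewrite powRr0 mulr1 powRM ?powR_ge0// -!powRrM.
have -> : (q^-1 - 1) * q = 1 - q by rewrite mulrBl mulVf ?mul1r// gt_eqF.
rewrite mulfV ?gt_eqF ?subr_gt0// powRr1 ?(ltW mu0)// => H.
apply: (le_trans H); rewrite le_eqVlt; apply/orP; left; apply/eqP; ring.
Qed.

(** The right side of the hypothesis is least at [mu = (B / A) ^ (1/q)], where
    it equals the bound.  For [B = 0] that value is not positive, and the bound
    is the limit of the hypothesis as [mu] tends to [0]. *)
Lemma le_young_optimal (R : realType) (q z A B : R) :
  1 < q -> 0 < A -> 0 <= B ->
  (forall mu : R, 0 < mu -> z <= q^-1 * mu `^ (1 - q) * B + (1 - q^-1) * mu * A) ->
  z <= A `^ (1 - q^-1) * B `^ q^-1.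
Proof.
move=> q1 A0 B0 H.
have q0 : 0 < q by lra.
have iq1 : q^-1 < 1 by rewrite invf_lt1.
have iq0 : 0 < q^-1 by rewrite invr_gt0.
move: B0; rewrite le_eqVlt => /predU1P[B0|B0].
  rewrite -B0 powR0 ?gt_eqF// mulr0.
  apply/ler_addgt0Pr => e e0; rewrite add0r.
  (* The parameter is chosen so that the remaining term equals [e]. *)
  have c0 : 0 < (1 - q^-1) * A by rewrite mulr_gt0// subr_gt0.
  have := H (e / ((1 - q^-1) * A)) (divr_gt0 e0 c0).
  rewrite -B0 mulr0 add0r mulrAC [X in _ <= X]mulrC.
  by rewrite divfK// gt_eqF.
have := H (B `^ q^-1 * A `^ (- q^-1)) (mulr_gt0 (powR_gt0 _ B0) (powR_gt0 _ A0)).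
move=> h; apply: (le_trans h).
rewrite powRM ?powR_ge0// -!powRrM.
have -> : q^-1 * (1 - q) = q^-1 - 1 by field; rewrite gt_eqF.
have -> : - q^-1 * (1 - q) = 1 - q^-1 by field; rewrite gt_eqF.
have eA : A `^ (- q^-1) * A = A `^ (1 - q^-1).
  by rewrite -[X in _ * X](powRr1 (ltW A0)) -powRD ?(gt_eqF A0) ?implybT// addrC.
have eB : B `^ (q^-1 - 1) * B = B `^ q^-1.
  by rewrite -[X in _ * X](powRr1 (ltW B0)) -powRD ?(gt_eqF B0) ?implybT// subrK.
rewrite -eA -eB le_eqVlt; apply/orP; left; apply/eqP; ring.
Qed.

(** Hölder's inequality
      [\int w v <= (\int w)^(1 - 1/q) (\int w v^q)^(1/q)],
    with [|Z'| <= w v], [N' = w], [V' = w u] and [v^q <= u]: only the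
    majorants [N] and [V] have to be known as primitives, while [v] may be
    discontinuous. *)
Lemma holder_derive (R : realType) (q l r : R) (Z dZ N V w u v : R -> R) :
  1 < q -> l < r ->
  {within `[l, r], continuous Z} -> {within `[l, r], continuous N} ->
  {within `[l, r], continuous V} ->
  (forall t, t \in `]l, r[%R -> is_derive t 1 Z (dZ t)) ->
  (forall t, t \in `]l, r[%R -> is_derive t 1 N (w t)) ->
  (forall t, t \in `]l, r[%R -> is_derive t 1 V (w t * u t)) ->
  (forall t, t \in `]l, r[%R ->
     [/\ 0 <= w t, 0 <= v t, `|dZ t| <= w t * v t & v t `^ q <= u t]) ->
  0 < N r - N l ->
  `|Z r - Z l| <= (N r - N l) `^ (1 - q^-1) * (V r - V l) `^ q^-1.
Proof.
move=> q1 lr cZ cN cV hZ hN hV h N0.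
have q0 : 0 < q by lra.
have iq0 : 0 < q^-1 by rewrite invr_gt0.
apply: le_young_optimal => //.
  rewrite subr_ge0; apply: ge0_derive_le hV _ => //; first exact: ltW.
  move=> t /h[w0 _ _ vu]; rewrite mulr_ge0//.
  exact: le_trans (powR_ge0 _ _) vu.
move=> mu mu0.
pose c : R := q^-1 * mu `^ (1 - q); pose d : R := (1 - q^-1) * mu.
rewrite -/c -/d.
have -> : c * (V r - V l) + d * (N r - N l) =
  (c * V r + d * N r) - (c * V l + d * N l) by ring.
apply: (@derive_norm_le R l r Z dZ (fun t => c * V t + d * N t)
  (fun t => c * (w t * u t) + d * w t)) => //; first exact: ltW.
- by apply: within_continuousD; exact: within_continuousZl.
- move=> t tlr; have := hV t tlr; have := hN t tlr => ? ?.
  by apply: is_deriveD.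
- move=> t /h[w0 v0 dZw vu]; apply: (le_trans dZw).
  have -> : c * (w t * u t) + d * w t = w t * (c * u t + d) by ring.
  rewrite ler_wpM2l//; apply: (le_trans (le_young _ _ _ _ q1 mu0 v0)).
  by rewrite lerD2r ler_wpM2l// mulr_ge0 ?powR_ge0// ltW.
Qed.

(** * Primitives of the weighted powers *)

Lemma is_derive_powR_succ (R : realType) (e t : R) : 0 < t -> 0 < e ->
  is_derive t 1 (fun x => e^-1 * x `^ e) (t `^ (e - 1)).
Proof.
move=> t0 e0.
apply: (is_derive_eq (is_deriveZ _ _)).
  exact: is_derive1_powR.
by rewrite /GRing.scale/= mulrA mulVf ?mul1r// gt_eqF.
Qed.

Lemma is_derive_onem_powR_succ (R : realType) (e t : R) : t < 1 -> 0 < e ->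
  is_derive t 1 (fun x => - e^-1 * (1 - x) `^ e) ((1 - t) `^ (e - 1)).
Proof.
move=> t1 e0.
have t0 : 0 < 1 - t by rewrite subr_gt0.
have h1 : is_derive (1 - t) 1 (fun x => e^-1 * x `^ e) ((1 - t) `^ (e - 1)).
  exact: is_derive_powR_succ.
have h2 : is_derive t 1 (fun x : R => 1 - x) (0 - 1) by apply: is_deriveB.
have h3 := is_deriveN (@is_derive1_comp _ (fun x => e^-1 * x `^ e)
  (fun x => 1 - x) t _ _ h1 h2).
have -> : (fun x => - e^-1 * (1 - x) `^ e) =
  - ((fun x => e^-1 * x `^ e) \o (fun x : R => 1 - x)).
  by apply/funext => x; rewrite mulNr.
by apply: is_derive_eq h3 _; rewrite sub0r mulrN mulr1 opprK.
Qed.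

(** Continuity at [0] holds only from the right, since [x `^ e = 1] for
    negative [x]. *)
Lemma within_continuous_powR (R : realType) (e r : R) : 0 < e -> 0 < r ->
  {within `[0, r], continuous (fun x : R => x `^ e)}.
Proof.
move=> e0 r0.
have cpos x : 0 < x -> {for x, continuous (fun x : R => x `^ e)}.
  move=> x0; apply: differentiable_continuous; apply/derivable1_diffP.
  by apply: derivable_powR; rewrite in_itv/= x0.
apply/continuous_within_itvP => //; split.
- by move=> x; rewrite in_itv/= => /andP[/cpos].
- by rewrite powR0 ?gt_eqF//; exact: powR_cvg0.
- by apply: cvg_at_left_filter; exact: cpos.
Qed.

Lemma derive_within_continuous (R : realType) (l r : R) (F dF : R -> R) :
  (forall t, t \in `[l, r]%R -> is_derive t 1 F (dF t)) ->
  {within `[l, r], continuous F}.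
Proof.
move=> h; apply: derivable_within_continuous => t /h; by case.
Qed.

Lemma primitive_weight (R : realType) : exists2 N : R -> R,
  (forall t : R, is_derive t 1 N (t ^+ 2 * (1 / 2 - t))) &
  N (1 / 2) - N 0 = 1 / 192.
Proof.
exists (fun t : R => 6^-1 *: t ^+ 3 - 4^-1 *: t ^+ 4); last first.
  by rewrite /GRing.scale/=; field.
move=> t; apply: is_derive_eq.
by rewrite /GRing.scale/=; field.
Qed.

(** The factor [2 `^ (- 4 - e)] is isolated so that it is the only power with
    a real exponent left in the values of the primitives at [1 / 2]. *)
Lemma powR_half (R : realType) (n : nat) (e : R) :
  (1 / 2) `^ (n%:R + e) = 2 `^ (- 4 - e) * 2 ^+ 4 / 2 ^+ n.
Proof.
have e2 k : (2 : R) ^+ k = 2 `^ k%:R by rewrite powR_mulrn.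
have n0 : (2 : R) != 0 by [].
rewrite div1r -powR_inv1// -powRrM !e2 -powRN -!powRD ?n0 ?implybT//.
by congr powR; lra.
Qed.

Lemma primitive_weight_powR (R : realType) (s : R) : 0 < s ->
  exists V : R -> R,
  [/\ {within `[0, 1 / 2], continuous V},
  (forall t : R, t \in `]0, 1 / 2[%R ->
    is_derive t 1 V (t ^+ 2 * (1 / 2 - t) * t `^ s)) &
  V (1 / 2) - V 0 = 2 `^ (- 4 - s) / ((3 + s) * (4 + s))].
Proof.
move=> s0.
have s3 : 0 < 3 + s by lra.
have s4 : 0 < 4 + s by lra.
exists (fun t => 1 / 2 * ((3 + s)^-1 * t `^ (3 + s)) +
                 (-1) * ((4 + s)^-1 * t `^ (4 + s))); split.
- apply: within_continuousD; do 2 apply: within_continuousZl;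
    apply: within_continuous_powR => //; lra.
- move=> t; rewrite in_itv/= => /andP[t0 _].
  have := is_derive_powR_succ _ _ _ t0 s3 => h3.
  have := is_derive_powR_succ _ _ _ t0 s4 => h4.
  have -> : t ^+ 2 * (1 / 2 - t) * t `^ s =
    1 / 2 * t `^ (3 + s - 1) + (-1) * t `^ (4 + s - 1).
    have -> : 3 + s - 1 = 2%:R + s by lra.
    have -> : 4 + s - 1 = 3%:R + s by lra.
    rewrite !(powRD, powR_mulrn) ?(gt_eqF t0) ?implybT ?ltW//.
    by field.
  by apply: is_deriveD; apply: is_deriveZ.
- rewrite !powR0 ?gt_eqF// !powR_half; field.
  by rewrite !gt_eqF.
Qed.

(** In terms of [w = 1 - t] the weight [t ^+ 2 * (1 / 2 - t)] is
    [w ^+ 3 - 5 / 2 * w ^+ 2 + 2 * w - 1 / 2], whence the four terms of the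
    primitive. *)
Lemma primitive_weight_onem_powR (R : realType) (s : R) : 0 < s ->
  exists V : R -> R,
  [/\ {within `[0, 1 / 2], continuous V},
  (forall t : R, t \in `]0, 1 / 2[%R ->
    is_derive t 1 V (t ^+ 2 * (1 / 2 - t) * (1 - t) `^ s)) &
  V (1 / 2) - V 0 = 2 `^ (- 4 - s) *
    (34 + 2 `^ (4 + s) * (- 2 + s) + 11 * s + s ^+ 2)
    / ((1 + s) * (2 + s) * (3 + s) * (4 + s))].
Proof.
move=> s0.
have s1 : 0 < 1 + s by lra.
have s2 : 0 < 2 + s by lra.
have s3 : 0 < 3 + s by lra.
have s4 : 0 < 4 + s by lra.
pose P (e t : R) : R := - e^-1 * (1 - t) `^ e.
pose V (t : R) : R := P (4 + s) t + (- (5 / 2)) * P (3 + s) t + 2 * P (2 + s) t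
                  + (- (1 / 2)) * P (1 + s) t.
have hV (t : R) : t < 1 -> is_derive t 1 V (t ^+ 2 * (1 / 2 - t) * (1 - t) `^ s).
  move=> t1.
  have := is_derive_onem_powR_succ _ _ _ t1 s1 => h1.
  have := is_derive_onem_powR_succ _ _ _ t1 s2 => h2.
  have := is_derive_onem_powR_succ _ _ _ t1 s3 => h3.
  have := is_derive_onem_powR_succ _ _ _ t1 s4 => h4.
  have t0 : 0 < 1 - t by rewrite subr_gt0.
  have -> : t ^+ 2 * (1 / 2 - t) * (1 - t) `^ s =
    (1 - t) `^ (4 + s - 1) + (- (5 / 2)) * (1 - t) `^ (3 + s - 1)
    + 2 * (1 - t) `^ (2 + s - 1) + (- (1 / 2)) * (1 - t) `^ (1 + s - 1).
    have -> : 4 + s - 1 = 3%:R + s by lra.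
    have -> : 3 + s - 1 = 2%:R + s by lra.
    have -> : 2 + s - 1 = 1%:R + s by lra.
    have -> : 1 + s - 1 = s by lra.
    rewrite !(powRD, powR_mulrn) ?(gt_eqF t0) ?implybT ?ltW//.
    by field.
  by do 3 ?[apply: is_deriveD]; try exact: is_deriveZ.
exists V; split.
- apply: (@derive_within_continuous _ _ _ _
    (fun t => t ^+ 2 * (1 / 2 - t) * (1 - t) `^ s)) => t.
  by rewrite in_itv/= => /andP[_ t1]; apply: hV; lra.
- by move=> t; rewrite in_itv/= => /andP[_ t1]; apply: hV; lra.
- have -> : 2 `^ (4 + s) = (2 `^ (- 4 - s))^-1 :> R.
    by rewrite -powRN; congr powR; lra.
  have X0 : 0 < 2 `^ (- 4 - s) :> R by rewrite powR_gt0.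
  rewrite /V /P subr0 powR1.
  have -> : 1 - 1 / 2 = 1 / 2 :> R by lra.
  rewrite (powR_half _ 1) !powR_half; field.
  by rewrite !gt_eqF.
Qed.

(** * The error on one half of the interval *)

(** [Z] is what three integrations by parts of [K F3] leave behind, for
    [K = t ^+ 3 - t ^+ 2 / 2]: it has derivative [K F3], and since [K] has
    a double zero at [0] and a simple zero at [1 / 2], its increment only
    involves [F1] at [1 / 2]. *)
Lemma simpson_half_error (R : realType) (q s A B : R) (J F0 F1 F2 F3 : R -> R) :
  1 < q -> 0 < s ->
  (forall t : R, t \in `[0, 1 / 2]%R ->
     [/\ is_derive t 1 J (F0 t), is_derive t 1 F0 (F1 t),
         is_derive t 1 F1 (F2 t) & is_derive t 1 F2 (F3 t)]) ->
  (forall t : R, t \in `]0, 1 / 2[%R ->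
     `|F3 t| `^ q <= (1 - t) `^ s * A + t `^ s * B) ->
  `|2 * F0 (1 / 2) + F0 0 - 4^-1 * F1 (1 / 2) - 6 * (J (1 / 2) - J 0)|
  <= (1 / 192) `^ (1 - q^-1) *
     (2 `^ (- 4 - s) / ((3 + s) * (4 + s)) * B +
      2 `^ (- 4 - s) * (34 + 2 `^ (4 + s) * (- 2 + s) + 11 * s + s ^+ 2)
        / ((1 + s) * (2 + s) * (3 + s) * (4 + s)) * A) `^ q^-1.
Proof.
move=> q1 s0 hF hA.
pose Z (t : R) : R := (t ^+ 3 - 2^-1 *: t ^+ 2) * F2 t - (3 *: t ^+ 2 - t) * F1 t
  + (6 *: t - 1) * F0 t - 6 *: J t.
have hZ (t : R) : t \in `[0, 1 / 2]%R ->
    is_derive t 1 Z ((t ^+ 3 - 2^-1 *: t ^+ 2) * F3 t).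
  move=> /hF[dJ d0 d1 d2]; apply: is_derive_eq.
  by rewrite /GRing.scale/=; field.
have -> : 2 * F0 (1 / 2) + F0 0 - 4^-1 * F1 (1 / 2) - 6 * (J (1 / 2) - J 0)
          = Z (1 / 2) - Z 0.
  by rewrite /Z /GRing.scale/=; field.
have [N dN N0] := primitive_weight R; rewrite -N0.
have [V [cV dV <-]] := primitive_weight_powR R s s0.
have [U [cU dU <-]] := primitive_weight_onem_powR R s s0.
have -> : (V (1 / 2) - V 0) * B + (U (1 / 2) - U 0) * A =
  (B * V (1 / 2) + A * U (1 / 2)) - (B * V 0 + A * U 0) by ring.
have sub (t : R) : t \in `]0, 1 / 2[%R -> t \in `[0, 1 / 2]%R.
  by rewrite !in_itv/= => /andP[/ltW -> /ltW ->].
pose W (t : R) : R := B * V t + A * U t.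
rewrite -[B * V (1 / 2) + _]/(W (1 / 2)) -[B * V 0 + _]/(W 0).
have cW : {within `[0, 1 / 2], continuous W}.
  by apply: within_continuousD; exact: within_continuousZl.
have dW (t : R) : t \in `]0, 1 / 2[%R -> is_derive t 1 W
    (t ^+ 2 * (1 / 2 - t) * ((1 - t) `^ s * A + t `^ s * B)).
  move=> th; have := dV t th; have := dU t th => hU hV.
  have -> : t ^+ 2 * (1 / 2 - t) * ((1 - t) `^ s * A + t `^ s * B) =
    B * (t ^+ 2 * (1 / 2 - t) * t `^ s) + A * (t ^+ 2 * (1 / 2 - t) * (1 - t) `^ s).
    by ring.
  by apply: is_deriveD; exact: is_deriveZ.
clearbody Z W.
apply: (holder_derive _ _ _ _ _ _ _ W _ _ (fun t => `|F3 t|) q1 _ _ _ cW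
  (fun t tI => hZ t (sub t tI)) (fun t _ => dN t) dW).
- by lra.
- exact: derive_within_continuous hZ.
- by apply: derive_within_continuous => t _; exact: dN.
- move=> t th; move: (th); rewrite in_itv/= => /andP[t0 t1].
  have w0 : 0 <= t ^+ 2 * (1 / 2 - t) by rewrite mulr_ge0 ?sqr_ge0//; lra.
  split => //; last exact: hA.
  have -> : t ^+ 3 - 2^-1 *: t ^+ 2 = - (t ^+ 2 * (1 / 2 - t)).
    by rewrite /GRing.scale/=; field.
  by rewrite mulNr normrN normrM ger0_norm.
- by rewrite N0.
Qed.

(** * Assembling the two halves *)

(** The integral starts from [l < a], so that the primitive has two-sided
    derivatives at [a] and [b] as well. *)
Lemma exists_primitive (R : realType) (f : R -> R) (l a b r : R) :
  l < a -> a <= b -> b < r ->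
  (forall x, x \in `[l, r]%R -> {for x, continuous f}) ->
  exists2 P : R -> R, (forall x, x \in `[a, b]%R -> is_derive x 1 P (f x)) &
    \int[@lebesgue_measure R]_(x in `[a, b]) f x = P b - P a.
Proof.
move=> la ab br cf.
have intf : (@lebesgue_measure R).-integrable `[l, r] (EFin \o f).
  apply: continuous_compact_integrable; first exact: segment_compact.
  by apply: continuous_in_subspaceT => x; rewrite inE/= => /cf.
exists (fun x => \int[@lebesgue_measure R]_(t in `[l, x]) f t).
  move=> x; rewrite in_itv/= => /andP[ax xb].
  have lx : l < x by exact: lt_le_trans ax.
  have xr : x < r by exact: le_lt_trans br.
  have [] := @continuous_FTC1_closed R f l x r xr intf lx.
    by apply: cf; rewrite in_itv/= !ltW.
  by move=> dP <-; rewrite derive1E; exact: derivableP.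
have intfb : (@lebesgue_measure R).-integrable `[l, b] (EFin \o f).
  by apply: integrableS intf => //; apply: subset_itvl; rewrite bnd_simp ltW.
rewrite (Rintegral_itvB intfb) ?bnd_simp ?(ltW la)// Rintegral_itv_obnd_cbnd//.
by apply: integrableS intfb => //; apply: subset_itvr; rewrite bnd_simp ltW.
Qed.

Lemma is_interval_interior (R : realType) (A : set R) :
  is_interval A -> is_interval (interior A).
Proof.
move=> iA x y Ax Ay z /andP[]; rewrite le_eqVlt => /predU1P[<- //|xz].
rewrite le_eqVlt => /predU1P[-> //|zy].
suff : `]x, y[ `<=` interior A by apply; rewrite /= in_itv/= xz.
rewrite -open_subsetE; last exact: interval_open.
move=> t /=; rewrite in_itv/= => /andP[xt ty].
by apply: (iA x y); [exact: interior_subset|exact: interior_subset|rewrite !ltW].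
Qed.

Lemma open_interval_enlarge (R : realType) (U : set R) (a b : R) :
  open U -> is_interval U -> U a -> U b ->
  exists l r : R, [/\ l < a, b < r & forall x, x \in `[l, r]%R -> U x].
Proof.
move=> oU iU Ua Ub.
have /nbhs_ballP[e /= e0 he] := open_nbhs_nbhs (conj oU Ua).
have /nbhs_ballP[d /= d0 hd] := open_nbhs_nbhs (conj oU Ub).
exists (a - e / 2), (b + d / 2); split; [lra|lra|].
move=> x; rewrite in_itv/=; apply: iU.
- by apply: he; rewrite /ball/= opprB addrC subrK ger0_norm; lra.
- by apply: hd; rewrite /ball/= opprD addrA subrr add0r normrN ger0_norm; lra.
Qed.

Lemma is_derive_affine (R : realType) (g : R -> R) (k x0 h t d : R) :
  is_derive (x0 + h * t) 1 g d ->
  is_derive t 1 (fun u : R => k * g (x0 + h * u)) (k * h * d).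
Proof.
move=> hg.
have ha : is_derive t 1 (fun u : R => x0 + h * u) (0 + h * 1).
  by apply: is_deriveD; apply: is_deriveZ.
have hc := @is_derive1_comp _ g (fun u : R => x0 + h * u) t _ _ hg ha.
have := is_deriveZ k hc.
by rewrite /GRing.scale/= add0r mulr1 [d * h]mulrC mulrA.
Qed.

(** Taking [F = h ^- 3 * f (x0 + h * t)] makes the third derivative in [t]
    exactly [f3], so the bound does not depend on [h].  A negative [h] reverses
    orientation and covers the right half. *)
Lemma simpson_half_error_affine (R : realType) (q s A B x0 h m : R)
    (P f f1 f2 f3 : R -> R) :
  1 < q -> 0 < s -> h != 0 -> m = x0 + h * (1 / 2) ->
  (forall t : R, t \in `[0, 1 / 2]%R -> let x := x0 + h * t in
     [/\ is_derive x 1 P (f x), is_derive x 1 f (f1 x),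
         is_derive x 1 f1 (f2 x) & is_derive x 1 f2 (f3 x)]) ->
  (forall t : R, t \in `]0, 1 / 2[%R ->
     `|f3 (x0 + h * t)| `^ q <= (1 - t) `^ s * A + t `^ s * B) ->
  `|(2 * f m + f x0) / h ^+ 3 - f1 m / (4 * h ^+ 2)
    - 6 * (P m - P x0) / h ^+ 4|
  <= (1 / 192) `^ (1 - q^-1) *
     (2 `^ (- 4 - s) / ((3 + s) * (4 + s)) * B +
      2 `^ (- 4 - s) * (34 + 2 `^ (4 + s) * (- 2 + s) + 11 * s + s ^+ 2)
        / ((1 + s) * (2 + s) * (3 + s) * (4 + s)) * A) `^ q^-1.
Proof.
move=> q1 s0 h0 mE hf hA.
have hF (t : R) : t \in `[0, 1 / 2]%R ->
     [/\ is_derive t 1 (fun u => h ^- 4 * P (x0 + h * u)) (h ^- 3 * f (x0 + h * t)),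
         is_derive t 1 (fun u => h ^- 3 * f (x0 + h * u)) (h ^- 2 * f1 (x0 + h * t)),
         is_derive t 1 (fun u => h ^- 2 * f1 (x0 + h * u)) (h ^- 1 * f2 (x0 + h * t)) &
         is_derive t 1 (fun u => h ^- 1 * f2 (x0 + h * u)) (f3 (x0 + h * t))].
  move=> /hf[dP d0 d1 d2].
  split.
  - by apply: (is_derive_eq (is_derive_affine _ _ _ _ _ _ _ dP)); field.
  - by apply: (is_derive_eq (is_derive_affine _ _ _ _ _ _ _ d0)); field.
  - by apply: (is_derive_eq (is_derive_affine _ _ _ _ _ _ _ d1)); field.
  - by apply: (is_derive_eq (is_derive_affine _ _ _ _ _ _ _ d2)); field.
have := simpson_half_error R q s A B _ _ _ _ (fun t => f3 (x0 + h * t)) q1 s0 hF hA.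
rewrite mulr0 addr0 -mE; apply: le_trans.
rewrite le_eqVlt; apply/orP; left; apply/eqP; congr `|_|; field.
by [].
Qed.

Theorem theorem4 (R : realType) (I : set R) (f : R -> R) (a b p q s : R)
  (I_interval : is_interval I) (I_nonneg : I `<=` [set x | 0 <= x])
  (f_derivable : times_derivable_on 3 (interior I) f)
  (Ia : (interior I) a) (Ib : (interior I) b) (ab : a < b)
  (f3_integrable :
    (@lebesgue_measure R).-integrable `[a, b] (EFin \o f^`(3)))
  (q_gt1 : 1 < q) (pq : 1 / p + 1 / q = 1)
  (s_gt0 : 0 < s) (s_le1 : s <= 1)
  (f3_convex :
    s_convex_second_sense s `[a, b] (fun x => `|f^`(3) x| `^ q)) :
  `| (\int[@lebesgue_measure R]_(x in `[a, b]) f x)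
     - (b - a) / 6 * (f a + 4 * f ((a + b) / 2) + f b) |
  <= (b - a) ^+ 4 / 6 * (1 / 192) `^ (1 - 1 / q)
     * ( ( 2 `^ (- 4 - s) / ((3 + s) * (4 + s)) * `|f^`(3) a| `^ q
           + 2 `^ (- 4 - s)
             * (34 + 2 `^ (4 + s) * (- 2 + s) + 11 * s + s ^+ 2)
             / ((1 + s) * (2 + s) * (3 + s) * (4 + s))
             * `|f^`(3) b| `^ q ) `^ (1 / q)
       + ( 2 `^ (- 4 - s)
             * (34 + 2 `^ (4 + s) * (- 2 + s) + 11 * s + s ^+ 2)
             / ((1 + s) * (2 + s) * (3 + s) * (4 + s))
             * `|f^`(3) a| `^ q
           + 2 `^ (- 4 - s) / ((3 + s) * (4 + s)) * `|f^`(3) b| `^ q )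
           `^ (1 / q) ).
Proof.
have iU := is_interval_interior R I I_interval.
have [l [r [la br lrU]]] :=
  open_interval_enlarge R _ _ _ (@open_interior _ I) iU Ia Ib.
have df k x : (k < 3)%N -> interior I x -> is_derive x 1 f^`(k) (f^`(k.+1) x).
  by move=> k3 Ix; rewrite derive1nS derive1E; exact/derivableP/f_derivable.
have [P dP ->] : exists2 P : R -> R,
    (forall x, x \in `[a, b]%R -> is_derive x 1 P (f x)) &
    \int[@lebesgue_measure R]_(x in `[a, b]) f x = P b - P a.
  apply: (exists_primitive _ _ _ _ _ _ la (ltW ab) br) => x /lrU Ux.
  apply: differentiable_continuous; apply/derivable1_diffP.
  by case: (df 0 x isT Ux).
have abU x : x \in `[a, b]%R -> interior I x.
  by rewrite in_itv/=; exact: iU.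
have chain x : x \in `[a, b]%R -> [/\ is_derive x 1 P (f x),
    is_derive x 1 f (f^`(1) x), is_derive x 1 f^`(1) (f^`(2) x) &
    is_derive x 1 f^`(2) (f^`(3) x)].
  move=> xab; have Ux := abU x xab.
  by split; [exact: dP|exact: (df 0)|exact: (df 1)|exact: (df 2)].
have c0 : b - a != 0 by rewrite subr_eq0 gt_eqF.
have Nc0 : - (b - a) != 0 by rewrite oppr_eq0.
have aab : `[a, b] a by rewrite /= in_itv/= lexx ltW.
have bab : `[a, b] b by rewrite /= in_itv/= lexx ltW.
have left (t : R) : 0 <= t <= 1 ->
    `|f^`(3) (a + (b - a) * t)| `^ q
    <= (1 - t) `^ s * `|f^`(3) a| `^ q + t `^ s * `|f^`(3) b| `^ q.
  move=> /andP[t0 t1]; have -> : a + (b - a) * t = (1 - t) * a + t * b by ring.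
  by apply: f3_convex => //; [rewrite subr_ge0|rewrite subrK].
have right (t : R) : 0 <= t <= 1 ->
    `|f^`(3) (b + - (b - a) * t)| `^ q
    <= (1 - t) `^ s * `|f^`(3) b| `^ q + t `^ s * `|f^`(3) a| `^ q.
  move=> /andP[t0 t1]; have -> : b + - (b - a) * t = (1 - t) * b + t * a by ring.
  by apply: f3_convex => //; [rewrite subr_ge0|rewrite subrK].
have inO (t : R) : t \in `]0, 1 / 2[%R -> 0 <= t <= 1.
  by rewrite in_itv/= => /andP[t0 t1]; apply/andP; split; lra.
have inL (t : R) : t \in `[0, 1 / 2]%R -> a + (b - a) * t \in `[a, b]%R.
  by rewrite !in_itv/= => /andP[t0 t1]; apply/andP; split; nra.
have inR (t : R) : t \in `[0, 1 / 2]%R -> b + - (b - a) * t \in `[a, b]%R.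
  by rewrite !in_itv/= => /andP[t0 t1]; apply/andP; split; nra.
have mL : (a + b) / 2 = a + (b - a) * (1 / 2) by field.
have mR : (a + b) / 2 = b + - (b - a) * (1 / 2) by field.
pose g x := `|f^`(3) x| `^ q.
have L := simpson_half_error_affine R q s (g a) (g b) _ _ _ P f f^`(1) f^`(2)
  f^`(3) q_gt1 s_gt0 c0 mL.
have M := simpson_half_error_affine R q s (g b) (g a) _ _ _ P f f^`(1) f^`(2)
  f^`(3) q_gt1 s_gt0 Nc0 mR.
have {}L := L (fun t th => chain _ (inL t th)) (fun t th => left t (inO t th)).
have {}M := M (fun t th => chain _ (inR t th)) (fun t th => right t (inO t th)).
rewrite !(div1r q).
set m := (a + b) / 2 in L M *.
(* The bounds [M] and [L] concern the halves seen from [b] and from [a]; with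
   their odd powers of [h] of opposite signs, the terms in [f m] add up in
   the difference while those in the derivative at [m] cancel. *)
have -> : P b - P a - (b - a) / 6 * (f a + 4 * f m + f b) =
  (b - a) ^+ 4 / 6 *
  (((2 * f m + f b) / (- (b - a)) ^+ 3 - f^`(1)%classic m / (4 * (- (b - a)) ^+ 2)
    - 6 * (P m - P b) / (- (b - a)) ^+ 4) -
   ((2 * f m + f a) / (b - a) ^+ 3 - f^`(1)%classic m / (4 * (b - a) ^+ 2)
    - 6 * (P m - P a) / (b - a) ^+ 4)).
  by field.
have c4 : 0 <= (b - a) ^+ 4 / 6 by rewrite divr_ge0// exprn_ge0// subr_ge0 ltW.
rewrite normrM (ger0_norm c4) -[X in _ <= X]mulrA; apply: ler_wpM2l c4 _ _ _.
apply: (le_trans (ler_normB _ _)).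
rewrite [X in _ <= X]mulrDr; apply: lerD; first exact: M.
by rewrite [X in _ * X `^ _]addrC; exact: L.
Qed.
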